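(* Let $f\colon[a,b]\to\mathbb{R}$ be Laplace integrable on $[a,b]$ and let $\{g_n\}$ be a sequence of functions of bounded variation on $[a,b]$ with $\sup_nV(g_n,[a,b])<\infty$ that converges pointwise on $[a,b]$ to a function $g$. Let $G_n(x)=\int_a^xg_n$ and $G(x)=\int_a^xg$. Then $\lim_{n\to\infty}\int_a^bfG_n=\int_a^bfG$.
   Context: Laplace integral on $[a,b]$: with lower/upper Laplace derivates $\underline{LD}_1F(x)$, $\overline{LD}_1F(x)$ being the minimum of the $\liminf$'s, resp. maximum of the $\limsup$'s, as $s\to\infty$ of $s^2\int_0^\delta e^{-st}[F(x+t)-F(x)]dt$ and $(-s^2)\int_0^\delta e^{-st}[F(x-t)-F(x)]dt$ (one-sided at endpoints), a major function of $f$ is a continuous $U$ with $\underline{LD}_1U\geqslant f$, $\underline{LD}_1U>-\infty$ everywhere on $[a,b]$, a minor function a continuous $V$ with $\overline{LD}_1V\leqslant f$, $\overline{LD}_1V<\infty$ everywhere, and $f$ is Laplace integrable if $\sup_V(V(b)-V(a))=\inf_U(U(b)-U(a))$ is finite, this value being $\int_a^bf$. $V(g_n,[a,b])$ is the total variation of $g_n$ on $[a,b]$ (''uniform bounded variation''). *)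

(* Defs.v *)
From HB Require Import structures.
From mathcomp Require Import all_boot all_order all_algebra.
From mathcomp Require Import all_classical all_reals all_analysis.
Set Implicit Arguments. Unset Strict Implicit. Unset Printing Implicit Defensive.
Import Order.TTheory GRing.Theory Num.Theory.
Import numFieldNormedType.Exports.
Local Open Scope classical_set_scope.
Local Open Scope ring_scope.

Section Laplace.
Context {R : realType}.
Implicit Types (a b x s d : R) (F f : R -> R).

Definition leb := (@lebesgue_measure R).

Definition lap_right F x d s : R :=
  s ^+ 2 * Rintegral leb `[0, d] (fun t => expR (- (s * t)) * (F (x + t) - F x)).

Definition lap_left F x d s : R :=
  - s ^+ 2 * Rintegral leb `[0, d] (fun t => expR (- (s * t)) * (F (x - t) - F x)).

Definition liminf_pinfty (h : R -> R) : \bar R :=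
  limf_einf (fun s => (h s)%:E) (pinfty_nbhs R).
Definition limsup_pinfty (h : R -> R) : \bar R :=
  limf_esup (fun s => (h s)%:E) (pinfty_nbhs R).

Definition lower_LD1 a b F x : \bar R :=
  if x == a then liminf_pinfty (lap_right F x (b - a))
  else if x == b then liminf_pinfty (lap_left F x (b - a))
  else let d := Num.min (x - a) (b - x) in
       Order.min (liminf_pinfty (lap_right F x d)) (liminf_pinfty (lap_left F x d)).

Definition upper_LD1 a b F x : \bar R :=
  if x == a then limsup_pinfty (lap_right F x (b - a))
  else if x == b then limsup_pinfty (lap_left F x (b - a))
  else let d := Num.min (x - a) (b - x) in
       Order.max (limsup_pinfty (lap_right F x d)) (limsup_pinfty (lap_left F x d)).

Definition laplace_major a b f U : Prop :=
  {within `[a, b], continuous U} /\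
  forall x, x \in `[a, b] ->
    ((f x)%:E <= lower_LD1 a b U x)%E /\ (-oo < lower_LD1 a b U x)%E.

Definition laplace_minor a b f V : Prop :=
  {within `[a, b], continuous V} /\
  forall x, x \in `[a, b] ->
    (upper_LD1 a b V x <= (f x)%:E)%E /\ (upper_LD1 a b V x < +oo)%E.

Definition lap_lower a b f : \bar R :=
  ereal_sup [set (V b - V a)%:E | V in [set V | laplace_minor a b f V]].
Definition lap_upper a b f : \bar R :=
  ereal_inf [set (U b - U a)%:E | U in [set U | laplace_major a b f U]].

Definition laplace_integrable a b f : Prop :=
  lap_lower a b f = lap_upper a b f /\ lap_lower a b f \is a fin_num.

Definition laplace_integral a b f : R := fine (lap_upper a b f).

Definition primitive a (g : R -> R) : R -> R :=
  fun x => Rintegral leb `[a, x] g.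

End Laplace.

(* Main.v *)
(* If [g] is measurable and bounded by [K] on [[a, b]], [G] is its primitive and
   [U] is a major function of [f], then [U * G - int U g] has the same increments
   as [G x * U] near [x] up to [o(t)], so its Laplace derivates at [x] are those
   of [G x * U].  Replacing [G] by [G + C >= 0] and subtracting [C * V], with [V]
   a minor function of [f], gives a major function of [f * G]; exchanging [U] and
   [V] gives a minor one.  Their total increments differ by at most
   [4 * C * (U b - V b)], because [U - V] is nondecreasing.  For fixed [U] and [V]
   this bracket is uniform in [n] and passes to the limit by bounded convergence. *)
Require Import Defs.
From HB Require Import structures.
From mathcomp Require Import all_boot all_order all_algebra.
From mathcomp Require Import all_classical all_reals all_analysis.
From mathcomp Require Import measurable_realfun ring lra.
Import Order.TTheory GRing.Theory Num.Theory.
Import numFieldNormedType.Exports.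
Local Open Scope classical_set_scope.
Local Open Scope ring_scope.

(** * Lower limits at infinity, bounded measurable functions, the exponential kernel *)

Section theory.
Context {R : realType}.
Implicit Types (a b c d e s t x y : R) (A : set R) (D f g h F G U V : R -> R).

(** Encodes [c <= liminf h] at infinity with real numbers only, so that bounds can be added and
    scaled without sums of opposite infinities. *)
Definition asymp_ge h c :=
  forall e, 0 < e -> \forall s \near +oo, c - e <= h s.

Lemma le_liminf_pinftyP h c : (c%:E <= liminf_pinfty h)%E <-> asymp_ge h c.
Proof.
rewrite /liminf_pinfty limf_einfE; split => [ch e e0|ch].
- have : ((c - e)%:E < ereal_sup [set ereal_inf [set (h s)%:E | s in W]
      | W in pinfty_nbhs R])%E.
    by apply: lt_le_trans ch; rewrite lte_fin; lra.
  move=> /ereal_sup_gt[_ [W FW <-]] /ltW cW.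
  apply: filterS FW => s Ws; rewrite -lee_fin; apply: (le_trans cW).
  by apply: ereal_inf_lbound; exists s.
- apply/lee_subgt0Pr => e e0; apply: le_ereal_sup_tmp.
  eexists; first by exists [set s | c - e <= h s]; [exact: ch|].
  by apply: le_ereal_inf_tmp => _ [s cs <-]; rewrite -EFinB lee_fin.
Qed.

Lemma Rintegral_cst_itvcc a b c : a <= b ->
  Rintegral leb `[a, b] (fun=> c) = c * (b - a).
Proof.
move=> ab; rewrite Rintegral_cst//; congr (_ * _).
apply: (etrans (congr1 fine (lebesgue_measure_itv `[a, b]))).
by rewrite /= lte_fin; case: ltgtP ab => // -> _; rewrite subrr.
Qed.

(** Serves as the single side condition for integrals: unlike integrability it is stable under
    products, and it implies integrability on segments. *)
Definition bmeas A h :=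
  measurable_fun A h /\ exists B, forall x, A x -> `|h x| <= B.

Lemma bmeasD A g h : bmeas A g -> bmeas A h -> bmeas A (fun x => g x + h x).
Proof.
move=> [mg [B gB]] [mh [C hC]]; split; first exact: measurable_funD.
exists (B + C) => x Ax; apply: (le_trans (ler_normD _ _)).
by rewrite lerD ?gB ?hC.
Qed.

Lemma bmeasM A g h : bmeas A g -> bmeas A h -> bmeas A (fun x => g x * h x).
Proof.
move=> [mg [B gB]] [mh [C hC]]; split; first exact: measurable_funM.
by exists (B * C) => x Ax; rewrite normrM ler_pM ?gB ?hC.
Qed.

Lemma bmeas_cst A c : bmeas A (fun=> c).
Proof. by split; [exact: measurable_cst|exists `|c|]. Qed.

Lemma bmeasZ A c h : bmeas A h -> bmeas A (fun x => c * h x).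
Proof. by move=> hh; apply: bmeasM => //; exact: bmeas_cst. Qed.

Lemma bmeasN A h : bmeas A h -> bmeas A (fun x => - h x).
Proof.
move=> [mh [B hB]]; split; first exact: measurable_funN.
by exists B => x Ax; rewrite normrN hB.
Qed.

Lemma bmeasB A g h : bmeas A g -> bmeas A h -> bmeas A (fun x => g x - h x).
Proof. by move=> hg hh; apply: bmeasD => //; exact: bmeasN. Qed.

Lemma bmeasS A A' h : measurable A -> A' `<=` A -> bmeas A h -> bmeas A' h.
Proof.
move=> mA AA' [mh [B hB]]; split; first exact: measurable_funS mh.
by exists B => x /AA'; exact: hB.
Qed.

Lemma bmeas_integrable a b h : bmeas `[a, b] h ->
  leb.-integrable `[a, b] (EFin \o h).
Proof.
move=> [mh [B hB]]; apply: measurable_bounded_integrable => //.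
  exact/compact_finite_measure/segment_compact.
exists B; split; rewrite ?num_real// => x Bx y /= yab.
exact: le_trans (hB _ yab) (ltW Bx).
Qed.

Lemma continuous_bmeas a b h : {within `[a, b], continuous h} -> bmeas `[a, b] h.
Proof.
move=> ch; split; first exact: subspace_continuous_measurable_fun.
have [M [_ hM]] := compact_bounded (continuous_compact ch (@segment_compact _ a b)).
exists (M + 1) => x xab; apply: hM; first by rewrite ltrDl.
by exists x.
Qed.

Lemma bmeas_comp A A' (u : R -> R) h : measurable A ->
  measurable_fun A' u -> (forall x, A' x -> A (u x)) -> bmeas A h ->
  bmeas A' (h \o u).
Proof.
move=> mA mu uA [mh [B hB]]; split; last by exists B => x /uA; exact: hB.
by apply: measurable_comp mh mu => //; move=> _ [x A'x <-]; exact: uA.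
Qed.

(** From [exp u = exp (u / 3) ^ 3] and [exp (u / 3) >= u / 3]. The cube makes [s ^+ 2 * exp (- s r)]
    decay like [1 / s] for fixed [r > 0]. *)
Lemma expRN_cube (u : R) : 0 < u -> expR (- u) <= 27 / u ^+ 3.
Proof.
move=> u0; rewrite expRN.
have h := expR_ge1Dx (u / 3).
have -> : expR u = expR (u / 3) ^+ 3.
  by rewrite -expRM_natr; congr expR; field.
have -> : 27 / u ^+ 3 = ((u / 3) ^+ 3)^-1 by field; lra.
have u3 : 0 < u / 3 by rewrite divr_gt0.
by rewrite lef_pV2 ?posrE ?exprn_gt0 ?expR_gt0// lerXn2r ?nnegrE ?expR_ge0 ?ltW//; lra.
Qed.

(** The integrand times [s ^+ 2] has the antiderivative [Q]. The value tends to [1], so the factor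
    [s ^+ 2] turns an increment [eta * t] into [eta] in the limit. *)
Lemma integral_texpN s d : 0 < s -> 0 < d ->
  s ^+ 2 * Rintegral leb `[0, d] (fun t => expR (- (s * t)) * t) =
  1 - (1 + s * d) * expR (- (s * d)).
Proof.
move=> s0 d0.
pose Q t := - (1 + s * t) * expR (- (s * t)).
have dQ t : is_derive t 1 Q (s ^+ 2 * (expR (- (s * t)) * t)).
  have dl : is_derive t 1 (fun t => - (s * t)) (- s).
    by apply: is_derive_eq; rewrite /GRing.scale/=; ring.
  have de : is_derive t 1 (expR \o (fun t => - (s * t))) (expR (- (s * t)) * - s).
    exact: is_derive1_comp.
  have d1 : is_derive t 1 (fun t => - (1 + s * t)) (- s).
    by apply: is_derive_eq; rewrite /GRing.scale/=; ring.
  apply: (is_derive_eq (is_deriveM d1 de)).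
  by rewrite /GRing.scale/=; ring.
have cQ : continuous Q.
  move=> t; apply/differentiable_continuous/derivable1_diffP.
  exact: (@ex_derive _ _ _ _ _ _ _ (dQ t)).
have ci : continuous (fun t => expR (- (s * t)) * t).
  move=> t; apply: cvgM; last exact: cvg_id.
  apply: (continuous_comp (f := fun t => - (s * t)) (g := expR)); last exact: continuous_expR.
  by apply: cvgN; apply: cvgM; [exact: cvg_cst|exact: cvg_id].
have bi : bmeas `[0, d] (fun t => expR (- (s * t)) * t).
  by apply: continuous_bmeas; exact: continuous_subspaceT.
rewrite -RintegralZl//; last exact: bmeas_integrable bi.
rewrite /Rintegral (@continuous_FTC2 _ _ Q 0 d)//.
- by rewrite /= /Q mulr0 addr0 oppr0 expR0; ring.
- apply: continuous_subspaceT => t; apply: cvgM; [exact: cvg_cst|exact: ci].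
- split; [by move=> t _; exact: (@ex_derive _ _ _ _ _ _ _ (dQ t))| |].
  + exact/cvg_at_right_filter/cQ.
  + exact/cvg_at_left_filter/cQ.
- by move=> t _; rewrite derive1E; exact: (@derive_val _ _ _ _ _ _ _ (dQ t)).
Qed.

End theory.

(** * Truncated Laplace quotients and their local behaviour *)

Section lap.
Context {R : realType}.
Implicit Types (a b c d e s t x y : R) (A : set R) (D f g h F G U V : R -> R).

Lemma asymp_geD h1 h2 c1 c2 : asymp_ge h1 c1 -> asymp_ge h2 c2 ->
  asymp_ge (fun s => h1 s + h2 s) (c1 + c2).
Proof.
move=> H1 H2 e e0; have e20 : 0 < e / 2 by rewrite divr_gt0.
near=> s.
have : c1 - e / 2 <= h1 s by near: s; exact: H1.
have : c2 - e / 2 <= h2 s by near: s; exact: H2.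
lra.
Unshelve. all: by end_near. Qed.

Lemma asymp_geZ k h c : 0 <= k -> asymp_ge h c ->
  asymp_ge (fun s => k * h s) (k * c).
Proof.
move=> k0 H e e0; have k1 : 0 < k + 1 by lra.
near=> s.
have : c - e / (k + 1) <= h s by near: s; apply: H; exact: divr_gt0.
move=> /(ler_wpM2l k0); apply: le_trans.
rewrite mulrBr lerB// mulrCA ger_pMr// ler_pdivrMr//; lra.
Unshelve. all: by end_near. Qed.

(** Common form of the right and left quotients; [D] will be a signed increment. *)
Definition lap D d s : R :=
  s ^+ 2 * Rintegral leb `[0, d] (fun t => expR (- (s * t)) * D t).

Lemma bmeas_lap_kernel D d s : bmeas `[0, d] D ->
  bmeas `[0, d] (fun t => expR (- (s * t)) * D t).
Proof.
move=> bD; apply: bmeasM bD; apply/continuous_bmeas/continuous_subspaceT => t.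
apply: (continuous_comp (f := fun t => - (s * t)) (g := expR)); last exact: continuous_expR.
by apply: cvgN; apply: cvgM; [exact: cvg_cst|exact: cvg_id].
Qed.

Lemma integrable_lap_kernel D d s : bmeas `[0, d] D ->
  leb.-integrable `[0, d] (EFin \o (fun t => expR (- (s * t)) * D t)).
Proof. by move=> bD; apply: bmeas_integrable; exact: bmeas_lap_kernel. Qed.

Lemma lapD D1 D2 d s : bmeas `[0, d] D1 -> bmeas `[0, d] D2 ->
  lap (fun t => D1 t + D2 t) d s = lap D1 d s + lap D2 d s.
Proof.
move=> b1 b2; rewrite /lap -mulrDr -RintegralD//; try exact: integrable_lap_kernel.
by congr (_ * _); apply: eq_Rintegral => t _; rewrite mulrDr.
Qed.

Lemma lapZ k D d s : bmeas `[0, d] D ->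
  lap (fun t => k * D t) d s = k * lap D d s.
Proof.
move=> bD; rewrite /lap mulrCA -[X in _ = _ * X]RintegralZl//; last exact: integrable_lap_kernel.
by congr (_ * _); apply: eq_Rintegral => t _; rewrite mulrCA.
Qed.

Lemma eq_lap D1 D2 d s : (forall t, t \in `[0, d] -> D1 t = D2 t) ->
  lap D1 d s = lap D2 d s.
Proof.
move=> E; congr (_ * _); apply: eq_Rintegral => t.
by rewrite inE /= => td; rewrite E.
Qed.

(* Past [r] the kernel is at most [expR (- (s * r))], which beats [s ^+ 2];
   on [[0, r]] compare with the exact value for [D t = eta * t]. *)
Lemma lap_local_le D d r eta e : 0 < d -> 0 < r -> bmeas `[0, d] D ->
  (forall t, t \in `[0, d] -> t <= r -> D t <= eta * t) -> 0 < e ->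
  \forall s \near +oo, lap D d s <= eta + e.
Proof.
move=> d0 r0 bD Dle e0; have [mD [B DB]] := bD.
(* [L] bounds [D t - eta * t] on all of [[0, d]]. [K / s] will bound the sum of two errors: the
   kernel mass missing beyond [d], and the contribution of [t > r]. *)
pose L := `|B| + `|eta| * d.
have L0 : 0 <= L by rewrite addr_ge0 ?mulr_ge0// ltW.
pose K := `|eta| * 54 / d + 27 * L * d / r ^+ 3.
near=> s.
have s1 : 1 <= s by near: s; apply: nbhs_pinfty_ge; rewrite num_real.
have sd : d^-1 <= s by near: s; apply: nbhs_pinfty_ge; rewrite num_real.
have sK : K / e <= s by near: s; apply: nbhs_pinfty_ge; rewrite num_real.
have s0 : 0 < s by lra.
have sd1 : 1 <= s * d by rewrite -ler_pdivrMr// div1r.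
have pw t : t \in `[0, d] -> expR (- (s * t)) * D t <=
    eta * (expR (- (s * t)) * t) + L * expR (- (s * r)).
  move=> td; move: (td); rewrite in_itv/= => /andP[t0 tled].
  have [tr|rt] := leP t r.
    apply: (@le_trans _ _ (eta * (expR (- (s * t)) * t))); last first.
      by rewrite lerDl mulr_ge0// expR_ge0.
    by rewrite mulrCA ler_pM2l ?expR_gt0// Dle.
  have : D t - eta * t <= L.
    rewrite /L lerD//.
      by apply: le_trans (ler_norm _) _; apply: le_trans (DB _ td) (ler_norm _).
    apply: le_trans (ler_norm _) _.
    by rewrite normrN normrM ler_wpM2l// ger0_norm.
  move=> DL; rewrite -lerBlDl mulrCA -mulrBr.
  have [Dn|Dp] := leP (D t - eta * t) 0.
    apply: (@le_trans _ _ 0); last by rewrite mulr_ge0// expR_ge0.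
    by rewrite mulr_ge0_le0// expR_ge0.
  rewrite mulrC ler_pM ?expR_ge0//; first exact: ltW.
  by rewrite ler_expR lerN2 ler_pM2l// ltW.
have bid : bmeas `[0, d] (fun t => t).
  by apply: continuous_bmeas; apply: continuous_subspaceT => t; exact: cvg_id.
have : lap D d s <= eta * (1 - (1 + s * d) * expR (- (s * d))) +
    s ^+ 2 * (L * d * expR (- (s * r))).
  rewrite -integral_texpN// mulrCA -mulrDr /lap ler_pM2l ?exprn_gt0//.
  rewrite -RintegralZl//; last exact: integrable_lap_kernel.
  have -> : L * d * expR (- (s * r)) =
      Rintegral leb `[0, d] (fun=> L * expR (- (s * r))).
    by rewrite Rintegral_cst_itvcc ?ltW// subr0; ring.
  have b1 := bmeasZ (`[0, d]) eta _ (bmeas_lap_kernel _ _ s bid).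
  rewrite -RintegralD//.
  - apply: le_Rintegral => //; first exact: integrable_lap_kernel.
    by apply: bmeas_integrable; apply: bmeasD => //; exact: bmeas_cst.
  - exact: bmeas_integrable.
  - by apply: bmeas_integrable; exact: bmeas_cst.
move=> /le_trans; apply.
(* Since [1 <= s * d], the first factor is at most [2 * (s * d)]; hence [54 = 2 * 27]. *)
have E1 : (1 + s * d) * expR (- (s * d)) <= 54 / d / s.
  have sdp : 0 < s * d by lra.
  apply: (@le_trans _ _ ((2 * (s * d)) * (27 / (s * d) ^+ 3))).
    by apply: ler_pM; [lra|exact: expR_ge0|lra|exact: expRN_cube].
  have -> : 2 * (s * d) * (27 / (s * d) ^+ 3) = 54 / (s * d) / (s * d) by field; lra.
  have -> : 54 / d / s = 54 / (s * d) by field; lra.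
  by rewrite ler_pdivrMr// ler_peMr// divr_ge0// ltW.
have E2 : s ^+ 2 * expR (- (s * r)) <= 27 / r ^+ 3 / s.
  apply: (@le_trans _ _ (s ^+ 2 * (27 / (s * r) ^+ 3))).
    by rewrite ler_pM2l ?exprn_gt0// expRN_cube// mulr_gt0.
  by rewrite le_eqVlt; apply/orP; left; apply/eqP; field; lra.
have E1' : eta * (1 - (1 + s * d) * expR (- (s * d))) <= eta + `|eta| * (54 / d / s).
  rewrite mulrBr mulr1 lerD// (le_trans (ler_norm _))// normrN normrM.
  rewrite ler_wpM2l// ger0_norm// mulr_ge0 ?expR_ge0//; lra.
have E2' : s ^+ 2 * (L * d * expR (- (s * r))) <= L * d * (27 / r ^+ 3 / s).
  by rewrite mulrCA ler_wpM2l// mulr_ge0// ltW.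
have EK : `|eta| * (54 / d / s) + L * d * (27 / r ^+ 3 / s) = K / s.
  by rewrite /K; field; lra.
have : K / s <= e by rewrite ler_pdivrMr// mulrC -ler_pdivrMr.
lra.
Unshelve. all: by end_near. Qed.

(** An increment that is [o(t)] does not lower the derivate: apply the local upper bound to [- D],
    spending half of [e] on the slope and half on the error. *)
Lemma asymp_ge_lap_small D d : 0 < d -> bmeas `[0, d] D ->
  (forall eta, 0 < eta -> exists2 r, 0 < r &
     forall t, t \in `[0, d] -> t <= r -> `|D t| <= eta * t) ->
  asymp_ge (lap D d) 0.
Proof.
move=> d0 bD small e e0; have e2 : 0 < e / 2 by rewrite divr_gt0.
have [r r0 Dr] := small _ e2.
have bND := bmeasZ _ (-1) _ bD.
have Nle t : t \in `[0, d] -> t <= r -> -1 * D t <= e / 2 * t.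
  by move=> td tr; rewrite mulN1r (le_trans (ler_norm _))// normrN Dr.
have := lap_local_le _ _ _ _ _ d0 r0 bND Nle e2.
by apply: filterS => s; rewrite lapZ// ; lra.
Qed.

End lap.

(** * Laplace derivates, major and minor functions, monotonicity *)

Section derivates.
Context {R : realType}.
Implicit Types (a b c d e s t x y sg : R) (D f g h F G U V : R -> R).

(** The upper limit of integration in the derivates at [x], at endpoints and interior points
    alike. *)
Definition rad a b x : R :=
  if (x == a) || (x == b) then b - a else Num.min (x - a) (b - x).

(* [sg] is [1] or [-1] and selects the right or the left derivate at [x]. *)
Definition incr sg F x t : R := sg * (F (x + sg * t) - F x).

Lemma rad_gt0 a b x : a < b -> x \in `[a, b] -> 0 < rad a b x.
Proof.
rewrite in_itv/= /rad => ab /andP[ax xb]; case: ifPn; first by rewrite subr_gt0.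
by rewrite negb_or => /andP[xa xnb]; rewrite lt_min !subr_gt0 !lt_neqAle eq_sym xa xnb ax.
Qed.

Lemma rad_right a b x : x \in `[a, b[ -> x + rad a b x \in `[a, b].
Proof.
rewrite !in_itv/= /rad => /andP[ax xb].
have [->|xa] /= := eqVneq x a; first by apply/andP; lra.
rewrite (lt_eqF xb).
have := ge_min (b - x) (x - a) (b - x); rewrite lexx orbT.
have : 0 <= Num.min (x - a) (b - x) by rewrite le_min !subr_ge0 ax ltW.
by move=> ? ?; apply/andP; lra.
Qed.

Lemma rad_left a b x : x \in `]a, b] -> x - rad a b x \in `[a, b].
Proof.
rewrite !in_itv/= /rad => /andP[ax xb].
rewrite (gt_eqF ax)/=.
have [->|xnb] /= := eqVneq x b; first by apply/andP; lra.
have := ge_min (x - a) (x - a) (b - x); rewrite lexx.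
have : 0 <= Num.min (x - a) (b - x) by rewrite le_min !subr_ge0 xb ltW.
by move=> ? ?; apply/andP; lra.
Qed.

(** The membership condition selects the sides that exist: at an endpoint [rad] is the full length
    of the segment and the outward side fails the condition, while in the interior both sides
    satisfy it. *)
Definition lower_derivates_ge a b F x c := forall sg,
  sg = 1 \/ sg = -1 -> x + sg * rad a b x \in `[a, b] ->
  asymp_ge (lap (incr sg F x) (rad a b x)) c.

Lemma segment_in a b sg d x t : x \in `[a, b] -> x + sg * d \in `[a, b] ->
  sg = 1 \/ sg = -1 -> t \in `[0, d] -> x + sg * t \in `[a, b].
Proof.
rewrite !in_itv/= => /andP[ax xb] /andP[axd xdb] s1 /andP[t0 td].
by apply/andP; case: s1 axd xdb => ->; lra.
Qed.

Lemma bmeas_incr a b sg d x F : bmeas `[a, b] F -> x \in `[a, b] ->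
  x + sg * d \in `[a, b] -> sg = 1 \/ sg = -1 -> bmeas `[0, d] (incr sg F x).
Proof.
move=> bF xab xd s1; apply: bmeasZ; apply: bmeasB; last exact: bmeas_cst.
apply: (bmeas_comp (`[a, b]) (`[0, d]) (fun t => x + sg * t)) bF => //.
  by apply: measurable_funD => //; exact: measurable_funM.
by move=> t; exact: segment_in.
Qed.

Lemma lap_rightE F x d s : lap_right F x d s = lap (incr 1 F x) d s.
Proof.
by congr (_ * _); apply: eq_Rintegral => t _; rewrite /incr !mul1r.
Qed.

Lemma lap_leftE a b F x d s : bmeas `[a, b] F -> x \in `[a, b] ->
  x - d \in `[a, b] -> lap_left F x d s = lap (incr (-1) F x) d s.
Proof.
move=> bF xab xd; have bi : bmeas `[0, d] (incr (-1) F x).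
  by apply: (bmeas_incr a b) => //; [rewrite mulN1r|right].
rewrite -[RHS]opprK -[X in _ = - X]mulN1r -lapZ// /lap_left mulNr; congr (- (_ * _)).
by apply: eq_Rintegral => t _; rewrite /incr !mulN1r opprK.
Qed.

Lemma lower_derivates_geP a b F x c : a < b -> x \in `[a, b] ->
  lower_derivates_ge a b F x c <->
    (x < b -> asymp_ge (lap (incr 1 F x) (rad a b x)) c) /\
    (a < x -> asymp_ge (lap (incr (-1) F x) (rad a b x)) c).
Proof.
move=> ab xab; move: (xab); rewrite in_itv/= => /andP[ax xb]; split=> [H|[H1 H2] sg].
  split=> [xb'|ax']; apply: H; [by left| |by right|].
    by rewrite mul1r rad_right// in_itv/= ax.
  by rewrite mulN1r rad_left// in_itv/= xb andbT.
rewrite in_itv/= => -[] -> /andP[h1 h2]; [apply: H1|apply: H2].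
  rewrite lt_neqAle xb andbT; apply/negP => /eqP xE; move: h1 h2.
  by rewrite /rad xE eqxx orbT; lra.
rewrite lt_neqAle ax andbT; apply/negP => /eqP xE; move: h1 h2.
by rewrite /rad -xE eqxx/=; lra.
Qed.

Lemma lower_LD1P a b F x c : a < b -> bmeas `[a, b] F -> x \in `[a, b] ->
  (c%:E <= lower_LD1 a b F x)%E <-> lower_derivates_ge a b F x c.
Proof.
move=> ab bF xab; rewrite lower_derivates_geP//.
move: (xab); rewrite in_itv/= => /andP[ax xb].
have Rg d : lap_right F x d = lap (incr 1 F x) d.
  by apply/funext => s; exact: lap_rightE.
have Lf : a < x -> lap_left F x (rad a b x) = lap (incr (-1) F x) (rad a b x).
  move=> ax'; apply/funext => s; apply: (lap_leftE a b) => //.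
  by rewrite rad_left// in_itv/= xb andbT.
rewrite /lower_LD1 !Rg; move: Lf; rewrite /rad.
have [xa|xa] /= := eqVneq x a.
  rewrite xa ltxx le_liminf_pinftyP => _; split=> [H|[H _]]; last exact: H.
  by split=> // _.
have ax' : a < x by rewrite lt_neqAle eq_sym xa.
have [xb'|xb'] /= := eqVneq x b.
  move=> /(_ ax') ->; rewrite le_liminf_pinftyP xb' ltxx.
  by split=> [H|[_ H]]; [split|apply: H; rewrite -xb'].
have xltb : x < b by rewrite lt_neqAle xb'.
move=> /(_ ax') ->; rewrite le_min; split.
  by move=> /andP[/le_liminf_pinftyP ? /le_liminf_pinftyP ?]; split.
by move=> [H1 H2]; apply/andP; split; apply/le_liminf_pinftyP; auto.
Qed.

Lemma incrN sg F x : incr sg (\- F) x = fun t => -1 * incr sg F x t.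
Proof. by apply/funext => t; rewrite /incr/=; ring. Qed.

Lemma limsup_pinfty_leP h c :
  (limsup_pinfty h <= c%:E)%E <-> asymp_ge (\- h) (- c).
Proof.
by rewrite -le_liminf_pinftyP /liminf_pinfty -leeN2 -limf_einfN EFinN.
Qed.

Lemma lapN_incr a b sg F x d : bmeas `[a, b] F -> x \in `[a, b] ->
  x + sg * d \in `[a, b] -> sg = 1 \/ sg = -1 ->
  lap (incr sg (\- F) x) d = \- lap (incr sg F x) d.
Proof.
move=> bF xab xd s1; apply/funext => s; rewrite incrN lapZ ?mulN1r//.
exact: (bmeas_incr a b).
Qed.

(** As [limsup h = - liminf (- h)], negation reduces upper derivates to lower ones; later arguments
    treat lower ones only. *)
Lemma upper_LD1P a b F x c : a < b -> bmeas `[a, b] F -> x \in `[a, b] ->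
  (upper_LD1 a b F x <= c%:E)%E <-> lower_derivates_ge a b (\- F) x (- c).
Proof.
move=> ab bF xab; rewrite lower_derivates_geP//.
move: (xab); rewrite in_itv/= => /andP[ax xb].
have Rg : x < b -> lap (incr 1 (\- F) x) (rad a b x) = \- lap_right F x (rad a b x).
  move=> xb'; rewrite (lapN_incr a b)//; [|by rewrite mul1r rad_right// in_itv/= ax|by left].
  by apply/funext => s /=; rewrite lap_rightE.
have Lf : a < x -> lap (incr (-1) (\- F) x) (rad a b x) = \- lap_left F x (rad a b x).
  move=> ax'; rewrite (lapN_incr a b)//; [|by rewrite mulN1r rad_left// in_itv/= xb andbT|by right].
  apply/funext => s /=; rewrite (lap_leftE a b)//.
  by rewrite rad_left// in_itv/= xb andbT.
rewrite /upper_LD1; move: Rg Lf; rewrite /rad.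
have [xa|xa] /= := eqVneq x a.
  rewrite xa ltxx limsup_pinfty_leP => /(_ ab) -> _; split=> [H|[H _]]; last exact: H.
  by split=> // _.
have ax' : a < x by rewrite lt_neqAle eq_sym xa.
have [xb'|xb'] /= := eqVneq x b.
  move=> _ /(_ ax') ->; rewrite limsup_pinfty_leP xb' ltxx.
  by split=> [H|[_ H]]; [split|apply: H; rewrite -xb'].
have xltb : x < b by rewrite lt_neqAle xb'.
move=> /(_ xltb) -> /(_ ax') ->; rewrite ge_max; split.
  by move=> /andP[/limsup_pinfty_leP ? /limsup_pinfty_leP ?]; split.
by move=> [H1 H2]; apply/andP; split; apply/limsup_pinfty_leP; auto.
Qed.

Lemma laplace_majorP a b f U : a < b ->
  laplace_major a b f U <-> {within `[a, b], continuous U} /\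
    forall x, x \in `[a, b] -> lower_derivates_ge a b U x (f x).
Proof.
move=> ab; split=> [[cU H]|[cU H]]; split => // x xab; have bU := continuous_bmeas _ _ _ cU.
  by apply/lower_LD1P => //; case: (H _ xab).
have Hx := (lower_LD1P _ _ _ _ (f x) ab bU xab).2 (H _ xab).
by split => //; apply: lt_le_trans Hx; rewrite ltNyr.
Qed.

(** Carries results on major functions over to minor ones. *)
Lemma laplace_minorP a b f V : a < b ->
  laplace_minor a b f V <-> laplace_major a b (\- f) (\- V).
Proof.
move=> ab; rewrite laplace_majorP//.
split=> [[cV H]|[cV H]].
  have bV := continuous_bmeas _ _ _ cV.
  split; first by move=> x; apply: continuousN; exact: cV.
  by move=> x xab; apply/upper_LD1P => //; case: (H _ xab).
have cV' : {within `[a, b], continuous V}.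
  move=> x; rewrite (_ : V = \- (\- V)).
    by apply: (@continuousN _ _ _ (\- V : subspace `[a, b] -> R)); exact: cV.
  by apply/funext => y /=; rewrite opprK.
have bV := continuous_bmeas _ _ _ cV'.
split => // x xab.
have Hx := (upper_LD1P _ _ _ _ (f x) ab bV xab).2 (H _ xab).
by split => //; apply: le_lt_trans Hx _; rewrite ltry.
Qed.

(* A maximum of [F x + eta x] over [[x, y]] is not attained at [y] when
   [F x > F y], and the right derivate of [F] is negative where it is. *)
Lemma lap_nondecreasing a b F : a < b -> {within `[a, b], continuous F} ->
  (forall x, x \in `[a, b[ -> asymp_ge (lap (incr 1 F x) (rad a b x)) 0) ->
  {in `[a, b] &, {homo F : x y / x <= y}}.
Proof.
move=> ab cF H x y; rewrite !in_itv/= => /andP[ax xb] /andP[ay yb] xy.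
rewrite leNgt; apply/negP => Fyx.
have {}xy : x < y by rewrite lt_neqAle xy andbT; apply: contraTneq Fyx => ->; rewrite ltxx.
(* Half the mean rate of descent: [F z + eta * z] is still larger at [x] than at [y]. *)
pose eta := (F x - F y) / (2 * (y - x)).
have eta0 : 0 < eta by rewrite divr_gt0// ?mulr_gt0// subr_gt0.
have etaE : eta * (y - x) = (F x - F y) / 2 by rewrite /eta; field; lra.
have xyab : `[x, y] `<=` `[a, b].
  by move=> z/=; rewrite !in_itv/= => /andP[xz zy]; apply/andP; lra.
have cFxy := continuous_subspaceW xyab cF.
have cY : {within `[x, y], continuous (fun z => F z + eta * z)}.
  move=> z; apply: cvgD; first exact: cFxy.
  have : {within `[x, y], continuous (fun z => eta * z)}.
    by apply: continuous_subspaceT => u; apply: cvgM; [exact: cvg_cst|exact: cvg_id].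
  by apply.
have [z] := EVT_max (ltW xy) cY.
rewrite in_itv/= => /andP[xz zy] zmax.
have {}zy : z < y.
  rewrite lt_neqAle zy andbT; apply/negP => /eqP zy'.
  have := zmax x; rewrite in_itv/= lexx ltW// => /(_ isT); rewrite zy'; lra.
have zab : z \in `[a, b[ by rewrite in_itv/=; apply/andP; lra.
have zab' : z \in `[a, b] by rewrite in_itv/=; apply/andP; lra.
have r0 := rad_gt0 _ _ _ ab zab'.
have zr := rad_right _ _ _ zab.
have bI : bmeas `[0, rad a b z] (incr 1 F z).
  apply: (bmeas_incr a b) => //; last by left.
    exact: continuous_bmeas.
  by rewrite mul1r.
have yz0 : 0 < y - z by rewrite subr_gt0.
(* Maximality at [z], rewritten as a bound on the increments of [F] to the right of [z]. *)
have loc t : t \in `[0, rad a b z] -> t <= y - z -> incr 1 F z t <= - eta * t.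
  rewrite in_itv/= => /andP[t0 _] tyz.
  have := zmax (z + t); rewrite in_itv/= /incr !mul1r.
  by move=> /(_ ltac:(apply/andP; lra)); lra.
(* For large [s] the quotient would be at most [- eta + eta / 3] and at least [- eta / 3]. *)
have e3 : 0 < eta / 3 by rewrite divr_gt0.
have Hle := lap_local_le _ _ _ _ _ r0 yz0 bI loc e3.
have Hge := H _ zab _ e3.
have [s /= [s1 s2]] := filter_ex (filterI Hle Hge).
lra.
Qed.

End derivates.

(** * Primitives and the major function of a product *)

Section product.
Context {R : realType}.
Implicit Types (a b c d e s t x y sg : R) (D f g h F G P U V : R -> R).

(** The bound on [h] is asked at distance at most that of [y] from [x], so that one hypothesis
    serves for [y] on either side of [x]. *)
Lemma primitive_incr_le a b h B x y : bmeas `[a, b] h ->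
  x \in `[a, b] -> y \in `[a, b] ->
  (forall z, z \in `[a, b] -> `|z - x| <= `|y - x| -> `|h z| <= B) ->
  `|primitive a h y - primitive a h x| <= B * `|y - x|.
Proof.
move=> bh.
have main u v : u \in `[a, b] -> v \in `[a, b] -> u <= v ->
    (forall z, z \in `[u, v] -> `|h z| <= B) ->
    `|primitive a h v - primitive a h u| <= B * (v - u).
  rewrite !in_itv/= => /andP[au ub] /andP[av vb] uv hB.
  have bhv : bmeas `[a, v] h.
    by apply: bmeasS bh => // z/=; rewrite !in_itv/= => /andP[-> /le_trans]; exact.
  have bhuv : bmeas `[u, v] h.
    by apply: bmeasS bhv => // z/=; rewrite !in_itv/= => /andP[/(le_trans au) -> ->].
  have iuv := bmeas_integrable _ _ _ bhuv.
  rewrite /primitive Rintegral_itvB ?bnd_simp//; last exact: bmeas_integrable.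
  rewrite Rintegral_itv_obnd_cbnd; last first.
    by apply: integrableS iuv => //; exact: subset_itv_oc_cc.
  apply: le_trans; first exact: le_normr_Rintegral.
  rewrite -Rintegral_cst_itvcc//; apply: le_Rintegral => //.
  - by apply: bmeas_integrable; case: bhuv => mh _; split; [exact: measurableT_comp|exists B => z /hB; rewrite normr_id].
  - by apply: bmeas_integrable; exact: bmeas_cst.
move=> xab yab hB; have [xy|/ltW yx] := leP x y.
  rewrite (ger0_norm (x := y - x)) ?subr_ge0//; apply: main => // z.
  move: xab yab; rewrite !in_itv/= => /andP[? ?] /andP[? ?] /andP[? ?].
  by apply: hB; [rewrite in_itv/=; apply/andP; lra|rewrite !ger0_norm; lra].
rewrite distrC (ler0_norm (x := y - x)) ?subr_le0// opprB; apply: main => // z.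
move: xab yab; rewrite !in_itv/= => /andP[? ?] /andP[? ?] /andP[? ?].
by apply: hB; [rewrite in_itv/=; apply/andP; lra|rewrite !ler0_norm; lra].
Qed.

Lemma primitive_continuous a b h : a <= b -> bmeas `[a, b] h ->
  {within `[a, b], continuous (primitive a h)}.
Proof.
by move=> ab bh; apply: parameterized_integral_continuous => //; exact: bmeas_integrable.
Qed.

Lemma primitive_start a h : primitive a h a = 0.
Proof. by rewrite /primitive set_itv1 Rintegral_set1. Qed.

(* Stands for [P = int U dG]; unlike an equation with [primitive] it passes to
   [- U] and [- P] with no integrability side condition outside [[a, b]]. *)
Definition weighted_primitive a b K G U P := forall x y w,
  x \in `[a, b] -> y \in `[a, b] ->
  (forall z, z \in `[a, b] -> `|z - x| <= `|y - x| -> `|U z - U x| <= w) ->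
  `|P y - P x - U x * (G y - G x)| <= K * w * `|y - x|.

Lemma weighted_primitiveN a b K G U P :
  weighted_primitive a b K G U P -> weighted_primitive a b K G (\- U) (\- P).
Proof.
move=> H x y w xab yab Uw /=.
rewrite (_ : _ - _ = - (P y - P x - U x * (G y - G x))); last by ring.
rewrite normrN; apply: H => // z zab zx.
by have := Uw z zab zx; rewrite /= -opprD normrN.
Qed.

(** The left-hand side is the integral of [(U t - U x) * g t] from [x] to [y], with integrand at
    most [K * w] in norm. *)
Lemma primitive_weighted a b K g U : bmeas `[a, b] g -> bmeas `[a, b] U ->
  (forall x, x \in `[a, b] -> `|g x| <= K) ->
  weighted_primitive a b K (primitive a g) U (primitive a (U \* g)).
Proof.
move=> bg bU gK x y w xab yab Uw.
have bUg := bmeasM _ _ _ bU bg.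
have E u : u \in `[a, b] -> primitive a (fun t => (U t - U x) * g t) u =
    primitive a (U \* g) u - U x * primitive a g u.
  rewrite in_itv/= => /andP[au ub].
  have sub : `[a, u] `<=` `[a, b].
    by move=> z/=; rewrite !in_itv/= => /andP[-> /le_trans]; exact.
  have bg' : bmeas `[a, u] g by exact: bmeasS bg.
  have bUg' : bmeas `[a, u] (U \* g) by exact: bmeasS bUg.
  rewrite /primitive -RintegralZl//; last exact: bmeas_integrable.
  rewrite -RintegralB//; first last.
  - by apply: bmeas_integrable; exact: bmeasZ.
  - exact: bmeas_integrable.
  by apply: eq_Rintegral => t _ /=; rewrite mulrBl.
rewrite (_ : _ - _ = primitive a (fun t => (U t - U x) * g t) y -
  primitive a (fun t => (U t - U x) * g t) x); last by rewrite !E//; ring.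
apply: (primitive_incr_le a b) => //.
  by apply: bmeasM => //; apply: bmeasB => //; exact: bmeas_cst.
move=> z zab zx; rewrite normrM mulrC ler_pM//; [exact: gK|exact: Uw].
Qed.

(* The derivate of [U * (G + C) - P] only dominates [f * (G + C)] where [G + C] is
   nonnegative, hence the shift; the last term removes the surplus [C * f]. *)
Definition product_major C G U V P x := U x * (G x + C) - P x - C * V x.

(** The increment of the candidate is [L], the combination of those of [U] and [- V] with
    nonnegative coefficients [G x + C] and [C], plus an error [E]. Lipschitz continuity of [G],
    continuity of [U] and the weighted primitive bound make [E] an [o(t)]. *)
Lemma laplace_major_product a b K C f G U V P : a < b -> 0 <= K ->
  (forall x, x \in `[a, b] -> `|G x| <= C) ->
  (forall x y, x \in `[a, b] -> y \in `[a, b] -> `|G y - G x| <= K * `|y - x|) ->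
  {within `[a, b], continuous G} -> {within `[a, b], continuous P} ->
  weighted_primitive a b K G U P ->
  laplace_major a b f U -> laplace_minor a b f V ->
  laplace_major a b (f \* G) (product_major C G U V P).
Proof.
move=> ab K0 GC Glip cG cP wP.
move=> /(laplace_majorP _ _ _ _ ab)[cU HU].
move=> /(laplace_minorP _ _ _ _ ab)/(laplace_majorP _ _ _ _ ab)[cV HV].
apply/(laplace_majorP _ _ _ _ ab).
have aab : a \in `[a, b] by rewrite in_itv/= lexx ltW.
have C0 : 0 <= C by exact: le_trans (GC _ aab).
have cM : {within `[a, b], continuous (product_major C G U V P)}.
  rewrite (_ : product_major C G U V P = fun x => U x * (G x + C) - P x + C * (\- V) x); last first.
    by apply/funext => x; rewrite /product_major/=; ring.
  move=> x; apply: cvgD; last by apply: cvgM; [exact: cvg_cst|exact: cV].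
  apply: cvgB; last exact: cP.
  by apply: cvgM; [exact: cU|apply: cvgD; [exact: cG|exact: cvg_cst]].
split=> // x xab sg s1 xd.
set d := rad a b x in xd *; have d0 : 0 < d := rad_gt0 _ _ _ ab xab.
have bU := bmeas_incr _ _ _ _ _ _ (continuous_bmeas _ _ _ cU) xab xd s1.
have bV := bmeas_incr _ _ _ _ _ _ (continuous_bmeas _ _ _ cV) xab xd s1.
have bM := bmeas_incr _ _ _ _ _ _ (continuous_bmeas _ _ _ cM) xab xd s1.
pose L t := (G x + C) * incr sg U x t + C * incr sg (\- V) x t.
pose E t := incr sg (product_major C G U V P) x t - L t.
have bL : bmeas `[0, d] L by apply: bmeasD; exact: bmeasZ.
have bE : bmeas `[0, d] E by exact: bmeasB.
have -> : lap (incr sg (product_major C G U V P) x) d = fun s =>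
    (G x + C) * lap (incr sg U x) d s + C * lap (incr sg (\- V) x) d s + lap E d s.
  apply/funext => s; rewrite -!lapZ// -lapD; [|exact: bmeasZ|exact: bmeasZ].
  by rewrite -lapD//; apply: eq_lap => t _; rewrite /E /L; ring.
(* Matches the three summands of the quotient; the surplus [C * f x] cancels. *)
have -> : (f \* G) x = (G x + C) * f x + C * (- f x) + 0 by rewrite /=; ring.
apply: asymp_geD; first apply: asymp_geD.
- apply: asymp_geZ; last exact: HU.
  by have := GC _ xab; rewrite ler_norml; lra.
- by apply: asymp_geZ => //; exact: HV.
apply: asymp_ge_lap_small => // eta eta0.
(* The error will be at most [2 * K * w * t]; the [+ 1] keeps the denominator positive when
   [K = 0]. *)
pose w := eta / (2 * K + 1).
have w0 : 0 < w by rewrite divr_gt0//; lra.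
have [r r0 Ur] : exists2 r, 0 < r & forall z, z \in `[a, b] -> `|z - x| <= r ->
    `|U z - U x| <= w.
  have Ax : [set` `[a, b]] x by [].
  have /subspace_continuousP/(_ _ Ax)/cvgrPdist_le/(_ _ w0) := cU.
  move=> /nbhs_ballP[r /= r0 Ur].
  (* Halved because the ball is open while the bound is wanted up to equality. *)
  exists (r / 2); first by rewrite divr_gt0.
  move=> z zab zx; rewrite distrC; apply: Ur => //.
  rewrite /ball/= distrC (le_lt_trans zx)// ltr_pdivrMr//; lra.
exists r => // t td tr.
have yab : x + sg * t \in `[a, b] by exact: segment_in xd s1 td.
set y := x + sg * t in yab.
have t0 : 0 <= t by move: td; rewrite in_itv/= => /andP[].
have yx : `|y - x| = t.
  by rewrite /y addrC addKr; case: s1 => ->; rewrite ?mul1r ?mulN1r ?normrN ger0_norm.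
have -> : E t = sg * ((G y - G x) * (U y - U x) - (P y - P x - U x * (G y - G x))).
  by rewrite /E /L /incr /product_major -/y /=; ring.
rewrite normrM (_ : `|sg| = 1) ?mul1r; last first.
  by case: s1 => ->; rewrite ?normrN normr1.
have H1 : `|(G y - G x) * (U y - U x)| <= K * t * w.
  by rewrite normrM ler_pM// -?yx; [exact: Glip|apply: Ur => //; rewrite yx].
have H2 : `|P y - P x - U x * (G y - G x)| <= K * w * t.
  rewrite -yx; apply: wP => // z zab zx; apply: Ur => //.
  by rewrite (le_trans zx)// yx.
apply: (le_trans (ler_normB _ _)); apply: (le_trans (lerD H1 H2)).
have -> : K * t * w + K * w * t = (2 * K) * w * t by ring.
rewrite ler_wpM2r//; rewrite /w mulrCA ger_pMr// ler_pdivrMr//; lra.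
Qed.

End product.

(** * The Laplace integral: integrability criterion and bracket for a product *)

Section integral.
Context {R : realType}.
Implicit Types (a b c d e s t x y sg : R) (D f g h F G P U V : R -> R).

(** Used to normalise major functions to vanish at [a]. *)
Lemma laplace_majorB a b f U c : a < b -> laplace_major a b f U ->
  laplace_major a b f (fun x => U x - c).
Proof.
move=> ab /(laplace_majorP _ _ _ _ ab)[cU HU]; apply/(laplace_majorP _ _ _ _ ab); split.
  by move=> x; apply: cvgB; [exact: cU|exact: cvg_cst].
move=> x xab sg s1 xd; have -> : incr sg (fun x => U x - c) x = incr sg U x.
  by apply/funext => t; rewrite /incr; ring.
exact: HU.
Qed.

Lemma laplace_minorB a b f V c : a < b -> laplace_minor a b f V ->
  laplace_minor a b f (fun x => V x - c).
Proof.
move=> ab /(laplace_minorP _ _ _ _ ab) mV; apply/(laplace_minorP _ _ _ _ ab).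
have -> : \- (fun x => V x - c) = fun x => (\- V) x - (- c).
  by apply/funext => x /=; ring.
exact: laplace_majorB.
Qed.

(** The right derivates of [U] and [- V] are at least [f x] and [- f x], so that of [U - V] is at
    least [0]. *)
Lemma major_sub_minor_nondecreasing a b f U V : a < b ->
  laplace_major a b f U -> laplace_minor a b f V ->
  {in `[a, b] &, {homo (fun x => U x - V x) : x y / x <= y}}.
Proof.
move=> ab /(laplace_majorP _ _ _ _ ab)[cU HU].
move=> /(laplace_minorP _ _ _ _ ab)/(laplace_majorP _ _ _ _ ab)[cV HV].
apply: lap_nondecreasing => //; first by move=> x; apply: cvgD; [exact: cU|exact: cV].
move=> x xab; have xab' : x \in `[a, b].
  by move: xab; rewrite !in_itv/= => /andP[-> /ltW].
have s1 : 1 = 1 :> R \/ 1 = -1 :> R by left.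
have xd : x + 1 * rad a b x \in `[a, b] by rewrite mul1r rad_right.
have bU := bmeas_incr _ _ _ _ _ _ (continuous_bmeas _ _ _ cU) xab' xd s1.
have bV := bmeas_incr _ _ _ _ _ _ (continuous_bmeas _ _ _ cV) xab' xd s1.
have -> : lap (incr 1 (fun x => U x - V x) x) (rad a b x) = fun s =>
    lap (incr 1 U x) (rad a b x) s + lap (incr 1 (\- V) x) (rad a b x) s.
  apply/funext => s; rewrite -lapD//.
  by apply: eq_lap => t _; rewrite /incr/=; ring.
by rewrite -(subrr (f x)); apply: asymp_geD; [exact: HU|exact: HV].
Qed.

Lemma laplace_minor_le_major a b f U V : a < b ->
  laplace_major a b f U -> laplace_minor a b f V -> V b - V a <= U b - U a.
Proof.
move=> ab mU mV.
have aab : a \in `[a, b] by rewrite in_itv/= lexx ltW.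
have bab : b \in `[a, b] by rewrite in_itv/= lexx ltW.
by have := major_sub_minor_nondecreasing _ _ _ _ _ ab mU mV _ _ aab bab (ltW ab); lra.
Qed.

Lemma laplace_integralE a b f : laplace_integrable a b f ->
  lap_lower a b f = (laplace_integral a b f)%:E /\
  lap_upper a b f = (laplace_integral a b f)%:E.
Proof. by rewrite /laplace_integral => -[<- fl]; rewrite fineK. Qed.

Lemma laplace_integral_bounds a b f U V : laplace_integrable a b f ->
  laplace_major a b f U -> laplace_minor a b f V ->
  V b - V a <= laplace_integral a b f <= U b - U a.
Proof.
move=> /laplace_integralE[lE uE] mU mV; rewrite -!lee_fin -{1}lE -uE.
apply/andP; split; first by apply: ereal_sup_ubound; exists V.
by apply: ereal_inf_lbound; exists U.
Qed.

(** A Cauchy criterion: integrability follows from close pairs, without knowledge of the value. *)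
Lemma laplace_integrableP a b f : a < b ->
  laplace_integrable a b f <-> (forall e, 0 < e -> exists U V,
    [/\ laplace_major a b f U, laplace_minor a b f V &
        (U b - U a) - (V b - V a) <= e]).
Proof.
move=> ab; split=> [/laplace_integralE[lE uE] e e0|H].
  have e2 : 0 < e / 2 by rewrite divr_gt0.
  have : (lap_upper a b f < (laplace_integral a b f + e / 2)%:E)%E.
    by rewrite uE lte_fin ltrDl.
  have : ((laplace_integral a b f - e / 2)%:E < lap_lower a b f)%E.
    by rewrite lE lte_fin; lra.
  move=> /ereal_sup_gt[_ [V mV <-]]; rewrite lte_fin => hV.
  move=> /ereal_inf_lt[_ [U mU <-]]; rewrite lte_fin => hU.
  by exists U, V; split => //; lra.
have lu : (lap_lower a b f <= lap_upper a b f)%E.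
  apply: ge_ereal_sup => _ [V mV <-]; apply: le_ereal_inf_tmp => _ [U mU <-].
  by rewrite lee_fin (laplace_minor_le_major _ _ f).
have br U V : laplace_major a b f U -> laplace_minor a b f V ->
    ((V b - V a)%:E <= lap_lower a b f)%E /\ (lap_upper a b f <= (U b - U a)%:E)%E.
  by move=> mU mV; split; [apply: ereal_sup_ubound; exists V|apply: ereal_inf_lbound; exists U].
(* A single pair, here for [e = 1], already confines the lower value between two reals. *)
have fl : lap_lower a b f \is a fin_num.
  have [U [V [mU mV _]]] := H _ ltr01; have [h1 h2] := br _ _ mU mV.
  rewrite fin_numElt (lt_le_trans _ h1) ?ltNyr//=.
  by rewrite (le_lt_trans (le_trans lu h2)) ?ltry.
split => //; apply/eqP; rewrite eq_le lu/=; apply/lee_addgt0Pr => e e0.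
have [U [V [mU mV UV]]] := H _ e0; have [h1 h2] := br _ _ mU mV.
apply: (le_trans h2); apply: (@le_trans _ _ ((V b - V a)%:E + e%:E)%E).
  by rewrite -EFinD lee_fin; lra.
by rewrite leeD2r.
Qed.

(** Both candidates vanish at [a], so the gap is [(U b - V b) * (G b + 2 * C)] minus the integral of
    [(U - V) * g]. The factor [4] counts one [C] for [G b], two explicit ones and one for the
    integral. *)
Lemma laplace_product_bracket a b K f g U V (G := primitive a g)
    (C := K * (b - a))
    (Up := product_major C G U V (primitive a (U \* g)))
    (Vp := product_major C G V U (primitive a (V \* g))) :
  a < b -> bmeas `[a, b] g -> (forall x, x \in `[a, b] -> `|g x| <= K) ->
  laplace_major a b f U -> laplace_minor a b f V -> U a = 0 -> V a = 0 ->
  [/\ laplace_major a b (f \* G) Up, laplace_minor a b (f \* G) Vp &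
      (Up b - Up a) - (Vp b - Vp a) <= 4 * C * (U b - V b)].
Proof.
move=> ab bg gK mU mV Ua Va.
have aab : a \in `[a, b] by rewrite in_itv/= lexx ltW.
have bab : b \in `[a, b] by rewrite in_itv/= lexx ltW.
have K0 : 0 <= K by exact: le_trans (gK _ aab).
have cU : {within `[a, b], continuous U} by case: mU.
have cV : {within `[a, b], continuous V} by case: mV.
have bU := continuous_bmeas _ _ _ cU.
have bV := continuous_bmeas _ _ _ cV.
have Glip x y : x \in `[a, b] -> y \in `[a, b] -> `|G y - G x| <= K * `|y - x|.
  by move=> xab yab; apply: (primitive_incr_le a b) => // z zab _; exact: gK.
(* [G] vanishes at [a] and is Lipschitz with constant [K], whence [C = K * (b - a)]. *)
have GC x : x \in `[a, b] -> `|G x| <= C.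
  move=> xab; have := Glip _ _ aab xab.
  have -> : G a = 0 by exact: primitive_start.
  rewrite subr0 => /le_trans; apply.
  move: xab; rewrite in_itv/= => /andP[ax xb].
  by rewrite ler_wpM2l// ger0_norm; lra.
have cG : {within `[a, b], continuous G} by apply: primitive_continuous => //; exact: ltW.
have cPU : {within `[a, b], continuous (primitive a (U \* g))}.
  by apply: primitive_continuous; [exact: ltW|exact: bmeasM].
have cPV : {within `[a, b], continuous (primitive a (V \* g))}.
  by apply: primitive_continuous; [exact: ltW|exact: bmeasM].
have wU := primitive_weighted _ _ _ _ _ bg bU gK.
have wV := primitive_weighted _ _ _ _ _ bg bV gK.
have mono := major_sub_minor_nondecreasing _ _ _ _ _ ab mU mV.
split.
- exact: (laplace_major_product a b K).
- apply/(laplace_minorP _ _ _ _ ab).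
  (* [- Vp] is the same construction for [- f], with [- V] as major and [- U] as minor function. *)
  have -> : \- Vp = product_major C G (\- V) (\- U) (\- primitive a (V \* g)).
    by apply/funext => x; rewrite /Vp /product_major/=; ring.
  have -> : \- (f \* G) = (\- f) \* G by apply/funext => x /=; ring.
  refine (laplace_major_product _ _ _ _ _ _ _ _ _ ab K0 GC Glip cG _ _ _ _).
  + by move=> x; apply: cvgN; exact: cPV.
  + exact: weighted_primitiveN.
  + exact/(laplace_minorP _ _ _ _ ab).
  + apply/(laplace_minorP _ _ _ _ ab).
    have -> : \- (\- f) = f by apply/funext => x /=; rewrite opprK.
    have -> // : \- (\- U) = U by apply/funext => x /=; rewrite opprK.
(* [U - V] is nondecreasing and vanishes at [a]. *)
have Wbd z : z \in `[a, b] -> `|U z - V z| <= U b - V b.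
  move=> zab; move: (zab); rewrite in_itv/= => /andP[az zb].
  have := mono _ _ zab bab zb; have := mono _ _ aab zab az; rewrite Ua Va.
  by move=> ? ?; rewrite ger0_norm; lra.
have W0 : 0 <= U b - V b by apply: le_trans (Wbd b bab).
have PE : primitive a (U \* g) b - primitive a (V \* g) b =
    primitive a (fun x => (U x - V x) * g x) b.
  rewrite /primitive -RintegralB//.
  - by apply: eq_Rintegral => t _ /=; rewrite mulrBl.
  - by apply: bmeas_integrable; exact: bmeasM.
  - by apply: bmeas_integrable; exact: bmeasM.
have Pbd : `|primitive a (fun x => (U x - V x) * g x) b| <= C * (U b - V b).
  have bWg : bmeas `[a, b] (fun x => (U x - V x) * g x) by apply: bmeasM => //; exact: bmeasB.
  have : `|primitive a (fun x => (U x - V x) * g x) b -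
      primitive a (fun x => (U x - V x) * g x) a| <= (U b - V b) * K * `|b - a|.
    apply: (primitive_incr_le a b) => // z zab _.
    by rewrite normrM ler_pM// ?Wbd ?gK.
  rewrite primitive_start subr0 (ger0_norm (x := b - a)) ?subr_ge0 ?(ltW ab)//.
  by rewrite /C -mulrA mulrC.
rewrite /Up /Vp /product_major !primitive_start Ua Va.
have GCb : G b * (U b - V b) <= C * (U b - V b).
  by rewrite ler_wpM2r// (le_trans (ler_norm _)) ?GC.
move: Pbd; rewrite -PE ler_norml => /andP[]; lra.
Qed.

(** * Bounded convergence and functions of bounded variation *)

Lemma bounded_convergence_Rintegral a b (h : nat -> R -> R) h0 B :
  (forall n, measurable_fun `[a, b] (h n)) ->
  (forall n x, x \in `[a, b] -> `|h n x| <= B) ->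
  (forall x, x \in `[a, b] -> h ^~ x @ \oo --> h0 x) ->
  Rintegral leb `[a, b] (h n) @[n --> \oo] --> Rintegral leb `[a, b] h0.
Proof.
move=> mh hB hh0.
have mh0 : measurable_fun `[a, b] h0 by exact: measurable_fun_cvg mh hh0.
have iB : leb.-integrable `[a, b] (EFin \o (fun=> B)).
  by apply: bmeas_integrable; exact: bmeas_cst.
have [] := @dominated_convergence _ _ _ leb `[a, b] (measurable_itv _)
  (fun n => EFin \o h n) (EFin \o h0) (EFin \o (fun=> B)).
- by move=> n; apply/measurable_EFinP; exact: mh.
- exact/measurable_EFinP.
- by apply: aeW => x xab; apply: cvg_EFin; [exact: nearW|exact: hh0].
- exact: iB.
- by apply: aeW => x n xab; rewrite /= lee_fin hB.
move=> ih0 _ cv.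
apply: fine_cvg; rewrite fineK//; exact: integrable_fin_num.
Qed.

(** Composition with the projection [clamp] onto [[a, b]] extends [h] to a nondecreasing function on
    the line. *)
Lemma nondecreasing_segment_measurable a b h : a <= b ->
  {in `[a, b] &, nondecreasing_fun h} -> measurable_fun `[a, b] h.
Proof.
move=> ab ndh; pose clamp x := Num.max a (Num.min x b).
have cab x : clamp x \in `[a, b].
  by rewrite in_itv/= le_max lexx/= ge_max ab/= ge_min lexx orbT.
apply: (eq_measurable_fun (h \o clamp)).
  move=> x; rewrite inE/= in_itv/= => /andP[ax xb]; congr h.
  by rewrite /clamp min_l// max_r.
apply: nondecreasing_measurable => // x y xy /=; apply: ndh; rewrite ?cab//.
by rewrite /clamp ge_max !le_max lexx/= le_min !ge_min xy lexx !orbT.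
Qed.

(** By the Jordan decomposition into nondecreasing functions. *)
Lemma bounded_variation_measurable a b h : a <= b -> bounded_variation a b h ->
  measurable_fun `[a, b] h.
Proof.
move=> ab bv.
apply: (eq_measurable_fun ((fine \o pos_tv a h) \- (fine \o neg_tv a h))).
  by move=> x; rewrite inE/= => xab; rewrite (bounded_variation_pos_neg_tvE bv).
apply: measurable_funB; apply: nondecreasing_segment_measurable => //.
  by apply: fine_neg_tv_nondecreasing; exact: bounded_variationN.
exact: fine_neg_tv_nondecreasing.
Qed.

(** The norm of [h x - h a] is at most the variation on [[a, x]], hence that on [[a, b]]. *)
Lemma total_variation_bound a b h M x : x \in `[a, b] ->
  (total_variation a b h <= M%:E)%E -> `|h x| <= `|h a| + M.
Proof.
move=> xab; move: (xab); rewrite in_itv/= => /andP[ax xb] hM.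
have ab := le_trans ax xb.
have : `|h x - h a| <= M.
  rewrite -lee_fin; apply: le_trans hM.
  apply: le_trans (total_variation_ge _ ax) _.
  by apply: (total_variation_nondecreasing (b := b)) => //; rewrite in_itv/= lexx ab.
move=> hxa; rewrite -[h x](subrK (h a)) addrC.
by rewrite (le_trans (ler_normD _ _))// lerD2l.
Qed.

End integral.

Theorem theorem7p3 (R : realType) (a b : R) (f : R -> R)
    (g : nat -> R -> R) (g0 : R -> R) :
  a < b ->
  laplace_integrable a b f ->
  (forall n, bounded_variation a b (g n)) ->
  (exists M : R, forall n, (total_variation a b (g n) <= M%:E)%E) ->
  (forall x, x \in `[a, b] -> g ^~ x @ \oo --> g0 x) ->
  (forall n, laplace_integrable a b (f \* primitive a (g n))) /\
  laplace_integrable a b (f \* primitive a g0) /\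
  laplace_integral a b (f \* primitive a (g n)) @[n --> \oo] -->
    laplace_integral a b (f \* primitive a g0).
Proof.
move=> ab fint gbv [M gM] gg0.
have aab : a \in `[a, b] by rewrite in_itv/= lexx ltW.
have bab : b \in `[a, b] by rewrite in_itv/= lexx ltW.
have [B gaB] : exists B : R, forall n, `|g n a| <= B.
  have [B [_ HB]] := cvg_seq_bounded (cvgP _ (gg0 _ aab)).
  by exists (B + 1) => n; apply: HB; rewrite ?ltrDl.
(* Convergence at [a] bounds the values [g n a]; adding the variation bound gives one constant for
   all [g n] on [[a, b]], and for the limit [g0]. *)
pose K : R := B + M.
have gK n x : x \in `[a, b] -> `|g n x| <= K.
  by move=> xab; rewrite (le_trans (total_variation_bound _ _ _ _ _ xab (gM n)))// lerD2r.
have mg n : measurable_fun `[a, b] (g n) by apply: bounded_variation_measurable => //; exact: ltW.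
have bg n : bmeas `[a, b] (g n) by split => //; exists K => x; exact: gK.
have g0K x : x \in `[a, b] -> `|g0 x| <= K.
  move=> xab; have cn : `|g n x| @[n --> \oo] --> `|g0 x| by apply: cvg_norm; exact: gg0.
  rewrite -(cvg_lim _ cn)//; apply: limr_le; first exact: cvgP cn.
  by apply: nearW => n; exact: gK.
have bg0 : bmeas `[a, b] g0.
  by split; [exact: measurable_fun_cvg mg gg0|exists K].
have K0 : 0 <= K by exact: le_trans (gK 0%N _ aab).
pose C : R := K * (b - a).
have C0 : 0 <= C by rewrite mulr_ge0// subr_ge0 ltW.
have C1 : 0 < 4 * C + 1 by lra.
(* [U] and [V] depend only on [f], [K] and [e], so one pair serves every [g n] and [g0]. The [+ 1]
   below covers [C = 0]. *)
have minmax (e : R) : 0 < e -> exists U V : R -> R, [/\ laplace_major a b f U,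
    laplace_minor a b f V, U a = 0, V a = 0 & 4 * C * (U b - V b) <= e].
  move=> e0; have eC : 0 < e / (4 * C + 1) by exact: divr_gt0.
  have [U [V [mU mV UV]]] := (laplace_integrableP _ _ _ ab).1 fint _ eC.
  exists (fun x => U x - U a), (fun x => V x - V a); split.
  - exact: laplace_majorB.
  - exact: laplace_minorB.
  - exact: subrr.
  - exact: subrr.
  apply: (@le_trans _ _ (4 * C * (e / (4 * C + 1)))); first by apply: ler_wpM2l UV; rewrite mulr_ge0.
  by rewrite mulrCA ger_pMr// ler_pdivrMr//; lra.
have int h : bmeas `[a, b] h -> (forall x, x \in `[a, b] -> `|h x| <= K) ->
    laplace_integrable a b (f \* primitive a h).
  move=> bh hK; apply/(laplace_integrableP _ _ _ ab) => e e0.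
  have [U [V [mU mV Ua Va UV]]] := minmax _ e0.
  have [mP mQ PQ] := laplace_product_bracket _ _ _ _ _ _ _ ab bh hK mU mV Ua Va.
  by do 2 eexists; split; [exact: mP|exact: mQ|exact: le_trans PQ UV].
split; first by move=> n; apply: int => //; exact: gK.
split; first exact: int.
apply/cvgrPdist_le => e e0; have e2 : 0 < e / 2 by rewrite divr_gt0.
have [U [V [mU mV Ua Va UV]]] := minmax _ e2.
have cU : {within `[a, b], continuous U} by case: mU.
have [_ [BU hBU]] := continuous_bmeas _ _ _ cU.
(* The upper end of the bracket for the integral of [f] times the primitive of [h], with [U] and [V]
   fixed. *)
pose P h := product_major C (primitive a h) U V (primitive a (U \* h)) b -
  product_major C (primitive a h) U V (primitive a (U \* h)) a.
have near_int h : bmeas `[a, b] h -> (forall x, x \in `[a, b] -> `|h x| <= K) ->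
    P h - e / 2 <= laplace_integral a b (f \* primitive a h) <= P h.
  move=> bh hK.
  have [mP mQ PQ] := laplace_product_bracket _ _ _ _ _ _ _ ab bh hK mU mV Ua Va.
  have /andP[h1 h2] := laplace_integral_bounds _ _ _ _ _ (int _ bh hK) mP mQ.
  apply/andP; split; last exact: h2.
  by apply: le_trans h1; move: (le_trans PQ UV); rewrite /P; lra.
have cvP : P (g n) @[n --> \oo] --> P g0.
  (* [h] enters [P h] only through the integrals of [h] and [U * h], to which bounded convergence
     applies. *)
  have PE h : P h = U b * (primitive a h b + C) - primitive a (U \* h) b - C * V b.
    by rewrite /P /product_major !primitive_start Ua Va; ring.
  rewrite PE; under eq_fun do rewrite PE.
  apply: cvgB; last exact: cvg_cst.
  apply: cvgB.
    apply: cvgM; first exact: cvg_cst.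
    apply: cvgD; last exact: cvg_cst.
    exact: (bounded_convergence_Rintegral _ _ _ _ K).
  apply: (bounded_convergence_Rintegral _ _ (fun n => U \* g n) _ (BU * K)).
  - by move=> n; apply: measurable_funM => //; exact: subspace_continuous_measurable_fun.
  - by move=> n x xab; rewrite normrM ler_pM// ?hBU ?gK.
  - by move=> x xab; apply: cvgM; [exact: cvg_cst|exact: gg0].
(* Each integral lies at most [e / 2] below its [P], and the two values of [P] are eventually within
   [e / 2] of each other. *)
move/cvgrPdist_le : cvP => /(_ _ e2); apply: filterS => n Pn.
have /andP[? ?] := near_int _ bg0 g0K.
have /andP[? ?] := near_int _ (bg n) (gK n).
by move: Pn; rewrite !ler_norml => /andP[? ?]; apply/andP; lra.
Qed.
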